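(* Let $n\ge4$ and let $D$ be an $n\times n$ Euclidean distance matrix with embedding dimension $r=3$, with generating points $p^1,\ldots,p^n\in\mathbb{R}^r$ affinely spanning $\mathbb{R}^r$ and satisfying $\sum_{i=1}^n p^i=\mathbf{0}$. Let $P$ be the $n\times r$ matrix whose $i$-th row is $(p^i)^T$, and let $b=\mathrm{diag}(PP^T)$. Let $d^m\in\mathbb{R}^n$ and let $y^*$ be an optimal solution of the problem $$\min_{y\in\mathbb{R}^n}\ \|y-d^m\|^2\quad\text{subject to}\quad\begin{bmatrix}0&y^T\\ y&D\end{bmatrix}\text{ is an EDM of embedding dimension }r.$$ Then the point $q\in\mathbb{R}^r$ satisfying $\|q-p^i\|^2=y^*_i$ for all $i=1,\ldots,n$ exists and is given by $$q=\frac12(P^TP)^{-1}P^T(b-y^* ),$$ and it satisfies $q^Tq=\frac1n e^T(y^*-b)$.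
   Context: An $n\times n$ matrix $D=(d_{ij})$ is a Euclidean distance matrix (EDM) if there are points $p^1,\ldots,p^n$ (generating points of $D$) in some Euclidean space with $d_{ij}=\|p^i-p^j\|^2$ for all $i,j$; the dimension of their affine span is the embedding dimension of $D$. Here $e$ is the all-ones vector, $\mathrm{diag}(A)$ the vector of diagonal entries of $A$, and $\|\cdot\|$ the Euclidean norm. *)

(* Defs.v *)
From HB Require Import structures.
From mathcomp Require Import all_boot all_order all_algebra.
From mathcomp Require Import classical_sets reals.

Set Implicit Arguments.
Unset Strict Implicit.
Unset Printing Implicit Defensive.

Import Order.TTheory GRing.Theory Num.Theory.
Local Open Scope classical_set_scope.
Local Open Scope ring_scope.

(* The norm that MathComp-Analysis puts on matrices is the sup norm, hence an
   explicit Euclidean norm on column vectors. *)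
Definition enorm (R : realType) (k : nat) (x : 'cV[R]_k) : R :=
  Num.sqrt (\sum_(i < k) x i 0 ^+ 2).

Definition generating_points (R : realType) (n k : nat) (D : 'M[R]_n)
    (p : 'I_n -> 'cV[R]_k) : Prop :=
  forall i j, D i j = enorm (p i - p j) ^+ 2.

Definition affine_span (R : realType) (n k : nat) (p : 'I_n -> 'cV[R]_k) :
    set 'cV[R]_k :=
  [set x | exists c : 'I_n -> R,
     \sum_(i < n) c i = 1 /\ x = \sum_(i < n) c i *: p i].

(* A is a translate a + V of a linear subspace V of dimension r. *)
Definition affine_dim (R : realType) (k : nat) (A : set 'cV[R]_k) (r : nat) :
    Prop :=
  exists (a : 'cV[R]_k) (V : {vspace 'cV[R]_k}),
    \dim V = r /\ A = [set x | x - a \in V].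

(* The dimension of the affine span is the same for all systems of generating
   points of D, in whatever R^k they live, so it may be read off from any one
   of them. *)
Definition edm_of_embedding_dim (R : realType) (n : nat) (D : 'M[R]_n)
    (r : nat) : Prop :=
  exists (k : nat) (p : 'I_n -> 'cV[R]_k),
    generating_points D p /\ affine_dim (affine_span p) r.

Definition bordered (R : realType) (n : nat) (D : 'M[R]_n) (y : 'cV[R]_n) :
    'M[R]_(1 + n) :=
  block_mx 0 y^T y D.

Definition optimal_solution (R : realType) (n : nat) (D : 'M[R]_n) (r : nat)
    (dm y : 'cV[R]_n) : Prop :=
  edm_of_embedding_dim (bordered D y) r /\
  forall z : 'cV[R]_n, edm_of_embedding_dim (bordered D z) r ->
    enorm (y - dm) ^+ 2 <= enorm (z - dm) ^+ 2.

Definition points_mx (R : realType) (n k : nat) (p : 'I_n -> 'cV[R]_k) :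
    'M[R]_(n, k) :=
  \matrix_(i < n) (p i)^T.

Definition diag_of (R : realType) (n : nat) (A : 'M[R]_n) : 'cV[R]_n :=
  \col_(i < n) A i i.

Definition ones (R : realType) (n : nat) : 'cV[R]_n := const_mx 1.

(* Main.v *)
Require Import Defs.
From HB Require Import structures.
From mathcomp Require Import all_boot all_order all_algebra.
From mathcomp Require Import classical_sets reals.
From mathcomp Require Import ring lra.

Set Implicit Arguments.
Unset Strict Implicit.
Unset Printing Implicit Defensive.

Import Order.TTheory GRing.Theory Num.Theory.
Local Open Scope classical_set_scope.
Local Open Scope ring_scope.

(** Let x and z_1, ..., z_n in R^k realize the bordered matrix, let c be the
    centroid of the z_i and U the matrix with rows z_i - c.  Both U and P are
    centered realizations of D, so U U^T = P P^T.  With the left inverse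
    M = (P^T P)^-1 P^T of P, the rows of W = M U are orthonormal and lie in the
    r-dimensional direction space of the affine hull of x, z_1, ..., z_n, hence
    span it.  Writing x - c = W^T q transports x to a point q of R^r at the
    required distances from the p_i.  The equations |q - p_i|^2 = y_i read
    2 P q = b - y + |q|^2 e; since P^T e = 0, multiplying by P^T gives the
    formula for q, and multiplying by e^T gives the one for q^T q. *)

(** As the entry of a 1x1 product, the inner product is open to associativity and transposition of
    matrices; [dotE] returns to coordinates. *)
Definition dot (R : realType) (k : nat) (x y : 'cV[R]_k) : R :=
  (x^T *m y) 0 0.

Lemma dotC (R : realType) (k : nat) (x y : 'cV[R]_k) : dot x y = dot y x.
Proof. by rewrite /dot -[x^T *m y]trmxK trmx_mul trmxK [LHS]mxE. Qed.

Lemma dotDl (R : realType) (k : nat) (x x' y : 'cV[R]_k) :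
  dot (x + x') y = dot x y + dot x' y.
Proof. by rewrite /dot linearD mulmxDl mxE. Qed.

Lemma dot_suml (R : realType) (n k : nat) (x : 'I_n -> 'cV[R]_k) y :
  dot (\sum_i x i) y = \sum_i dot (x i) y.
Proof. by rewrite /dot linear_sum mulmx_suml summxE. Qed.

Lemma dot0l (R : realType) (k : nat) (y : 'cV[R]_k) : dot 0 y = 0.
Proof. by rewrite /dot trmx0 mul0mx mxE. Qed.

Lemma dotBB (R : realType) (k : nat) (x y : 'cV[R]_k) :
  dot (x - y) (x - y) = dot x x - 2 * dot x y + dot y y.
Proof.
have dotNl (u v : 'cV[R]_k) : dot (- u) v = - dot u v.
  by rewrite /dot linearN mulNmx mxE.
rewrite dotDl dotNl ![dot _ (x - y)]dotC !dotDl !dotNl (dotC y x).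
ring.
Qed.

Lemma dotE (R : realType) (k : nat) (x y : 'cV[R]_k) :
  dot x y = \sum_i x i 0 * y i 0.
Proof. by rewrite /dot mxE; apply: eq_bigr => i _; rewrite mxE. Qed.

Lemma dot_eq0 (R : realType) (k : nat) (x : 'cV[R]_k) :
  dot x x = 0 -> x = 0.
Proof.
rewrite dotE => /eqP; rewrite psumr_eq0 => [|i _]; last exact: sqr_ge0.
move=> /allP x0; apply/colP => i; rewrite mxE.
by apply/eqP; have := x0 i (mem_index_enum i); rewrite mulf_eq0 orbb.
Qed.

Lemma enorm_sqr (R : realType) (k : nat) (x : 'cV[R]_k) :
  enorm x ^+ 2 = dot x x.
Proof.
rewrite /enorm sqr_sqrtr; last by apply: sumr_ge0 => i _; exact: sqr_ge0.
by rewrite dotE; apply: eq_bigr => i _; rewrite expr2.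
Qed.

(* Double centering: the Gram matrix of a centered family is determined by the
   pairwise distances. *)
Lemma centered_gram (R : realType) (n k l : nat)
    (u : 'I_n -> 'cV[R]_k) (p : 'I_n -> 'cV[R]_l) :
  \sum_i u i = 0 -> \sum_i p i = 0 ->
  (forall i j, dot (u i - u j) (u i - u j) = dot (p i - p j) (p i - p j)) ->
  forall i j, dot (u i) (u j) = dot (p i) (p j).
Proof.
move=> su sp uv i0 j0.
have n0 : n%:R != 0 :> R by rewrite pnatr_eq0; case: (n) i0 => [[]|].
(* The cross terms add up to twice the inner product of [w i] with the sum of the family, which is
   zero. *)
have row m (w : 'I_n -> 'cV[R]_m) i : \sum_j w j = 0 ->
    \sum_j dot (w i - w j) (w i - w j) =
    n%:R * dot (w i) (w i) + \sum_j dot (w j) (w j).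
  move=> sw; under eq_bigr do rewrite dotBB.
  rewrite !big_split /= sumrN -mulr_sumr.
  under [X in 2 * X]eq_bigr do rewrite dotC.
  by rewrite -(dot_suml w) sw dot0l mulr0 subr0 sumr_const card_ord mulr_natl.
have row_eq i : n%:R * dot (u i) (u i) + \sum_j dot (u j) (u j) =
    n%:R * dot (p i) (p i) + \sum_j dot (p j) (p j).
  by rewrite -!row //; apply: eq_bigr => j _.
(* Summing [row_eq] over [i] counts the total [2 * n] times on each side. Once the totals agree,
   [row_eq] gives equal squared norms, and polarization the inner products. *)
have tot : \sum_j dot (u j) (u j) = \sum_j dot (p j) (p j).
  have : \sum_i (n%:R * dot (u i) (u i) + \sum_j dot (u j) (u j)) =
      \sum_i (n%:R * dot (p i) (p i) + \sum_j dot (p j) (p j)).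
    by apply: eq_bigr => i _.
  rewrite !big_split /= -!mulr_sumr !sumr_const card_ord.
  rewrite -(mulr_natl (\sum_j dot (u j) _)) -(mulr_natl (\sum_j dot (p j) _)).
  by rewrite -!mulrDr => /(mulfI n0); lra.
have sq i : dot (u i) (u i) = dot (p i) (p i).
  by apply: (mulfI n0); move: (row_eq i); rewrite tot => /addIr.
have := uv i0 j0; rewrite !dotBB !sq; lra.
Qed.

Lemma points_mx_tr_mul (R : realType) (n k : nat) (p : 'I_n -> 'cV[R]_k)
    (a : 'cV[R]_n) :
  (points_mx p)^T *m a = \sum_i a i 0 *: p i.
Proof.
apply/colP => j; rewrite mxE summxE; apply: eq_bigr => i _.
by rewrite !mxE mulrC.
Qed.

Lemma points_mx_mul (R : realType) (n k : nat) (p : 'I_n -> 'cV[R]_k)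
    (x : 'cV[R]_k) i : (points_mx p *m x) i 0 = dot (p i) x.
Proof. by rewrite /dot !mxE; apply: eq_bigr => j _; rewrite !mxE. Qed.

Lemma points_mx_gram (R : realType) (n k : nat) (p : 'I_n -> 'cV[R]_k) i j :
  (points_mx p *m (points_mx p)^T) i j = dot (p i) (p j).
Proof. by rewrite /dot !mxE; apply: eq_bigr => l _; rewrite !mxE. Qed.

(** A kernel vector [v] of the Gram matrix has |Pv|^2 = 0, so it is orthogonal to every [p i]. Being
    itself a combination of the [p i], it is orthogonal to itself. *)
Lemma spanning_gram_unit (R : realType) (n r : nat) (p : 'I_n -> 'cV[R]_r) :
  affine_span p = setT -> (points_mx p)^T *m points_mx p \in unitmx.
Proof.
move=> hspan; set P := points_mx p.
rewrite -row_free_unit; apply: inj_row_free => v vA.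
have Pv : P *m v^T = 0.
  apply: dot_eq0; rewrite /dot trmx_mul trmxK mulmxA -(mulmxA v) vA.
  by rewrite mul0mx mxE.
have : affine_span p v^T by rewrite hspan.
case=> c [_ vc]; apply: trmx_inj; rewrite trmx0; apply: dot_eq0.
rewrite {1}vc dot_suml big1 // => i _.
by rewrite /dot linearZ -scalemxAl mxE -/(dot _ _) -points_mx_mul -/P Pv mxE mulr0.
Qed.

Lemma transport_point (R : realType) (n r k : nat) (p : 'I_n -> 'cV[R]_r)
    (z : 'I_n -> 'cV[R]_k) (x : 'cV[R]_k) (V : {vspace 'cV[R]_k}) :
  (0 < n)%N -> affine_span p = setT -> \sum_i p i = 0 ->
  \dim V = r -> (forall i, z i - x \in V) ->
  (forall i j, enorm (z i - z j) ^+ 2 = enorm (p i - p j) ^+ 2) ->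
  exists q, forall i, enorm (q - p i) ^+ 2 = enorm (x - z i) ^+ 2.
Proof.
move=> n_gt0 hspan sp dimV zV zp.
have n0 : n%:R != 0 :> R by rewrite pnatr_eq0 -lt0n.
pose c := n%:R^-1 *: \sum_i z i; pose u i := z i - c.
have su : \sum_i u i = 0.
  by rewrite sumrB sumr_const card_ord -scaler_nat scalerA divff // scale1r subrr.
have xcV : x - c \in V.
  (* The weights 1/n sum to one, so [x] can be moved inside the average. *)
  have -> : x - c = - (n%:R^-1 *: \sum_i (z i - x)).
    rewrite sumrB sumr_const card_ord -scaler_nat scalerBr scalerA mulVf //.
    by rewrite scale1r opprB.
  by rewrite memvN memvZ // memv_suml.
have uV i : u i \in V by rewrite /u -(subrKA x) memvD.
have gram i j : dot (u i) (u j) = dot (p i) (p j).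
  apply: centered_gram => // {}i {}j.
  by rewrite -!enorm_sqr -zp /u opprB addrA subrK.
set P := points_mx p; pose U := points_mx u.
have UU : U *m U^T = P *m P^T.
  by apply/matrixP => i j; rewrite !points_mx_gram gram.
pose M := invmx (P^T *m P) *m P^T.
have MP : M *m P = 1%:M.
  by rewrite -mulmxA mulVmx // spanning_gram_unit.
pose W := M *m U.
(* Row by row, this says that [W] carries each [u i] to [p i]. *)
have UW : U *m W^T = P.
  by rewrite trmx_mul mulmxA UU -mulmxA -trmx_mul MP trmx1 mulmx1.
have WW : W *m W^T = 1%:M by rewrite -mulmxA UW MP.
pose f := linfun (mulmx W^T : 'cV[R]_r -> 'cV[R]_k).
(* Each value U^T (M^T a) is a combination of the [u i], hence in [V]. Since W W^T = 1, [f] is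
   injective, so its image has dimension r, that of [V]. *)
have limgV : limg f = V.
  apply/eqP; rewrite eqEdim; apply/andP; split.
    apply/subvP => _ /memv_imgP [a _ ->]; rewrite lfunE /= trmx_mul -mulmxA.
    by rewrite points_mx_tr_mul memv_suml // => i _; rewrite memvZ.
  rewrite limg_dim_eq; first by rewrite dimvf /dim /= dimV muln1.
  apply/eqP; rewrite capfv; apply/lker0P => a a'; rewrite !lfunE /=.
  by move=> /(congr1 (mulmx W)); rewrite !mulmxA WW !mul1mx.
move: xcV; rewrite -limgV => /memv_imgP [q _]; rewrite lfunE /= => xc.
exists q => i; rewrite !enorm_sqr.
have -> : x - z i = (x - c) - u i by rewrite /u opprB addrA subrK.
(* The squared norms of [q] and [x - c] agree because W W^T = 1, the cross terms because U W^T =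
   P. *)
rewrite (dotBB q) (dotBB (x - c)) gram; congr (_ - 2 * _ + _).
  by rewrite xc /dot trmx_mul trmxK mulmxA -(mulmxA q^T) WW mulmx1.
by rewrite dotC -points_mx_mul -/P -UW -mulmxA -xc points_mx_mul dotC.
Qed.

Lemma bordered_point (R : realType) (n r : nat) (D : 'M[R]_n)
    (p : 'I_n -> 'cV[R]_r) (y : 'cV[R]_n) :
  (0 < n)%N -> generating_points D p -> affine_span p = setT ->
  \sum_i p i = 0 -> edm_of_embedding_dim (bordered D y) r ->
  exists q, forall i, enorm (q - p i) ^+ 2 = y i 0.
Proof.
move=> n_gt0 hp hspan sp [k [z [hz [a [V [dimV zaV]]]]]].
have mem i : z i - a \in V.
  have : affine_span z (z i).
    (* Kronecker weights: each point lies in its own affine span. *)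
    exists (fun j => (j == i)%:R); split.
      by rewrite (bigD1 i) //= eqxx big1 ?addr0 // => j /negbTE ->.
    rewrite (bigD1 i) //= eqxx scale1r big1 ?addr0 // => j /negbTE ->.
    by rewrite scale0r.
  by rewrite zaV.
(* Index [lshift n 0] is the bordering row, so its point plays [x]; the indices [rshift 1 i] belong
   to the block [D]. *)
case: (@transport_point R n r k p (fun i => z (rshift 1 i)) (z (lshift n 0)) V).
- by [].
- by [].
- by [].
- by [].
- move=> i; rewrite -(subrKA a) memvD //.
  by rewrite -memvN opprB mem.
- by move=> i j; rewrite -hz -hp /bordered block_mxEdr.
by move=> q hq; exists q => i; rewrite hq -hz /bordered block_mxEur mxE.
Qed.

Lemma point_equations (R : realType) (n r : nat) (p : 'I_n -> 'cV[R]_r)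
    (q : 'cV[R]_r) (y : 'cV[R]_n) :
  (forall i, enorm (q - p i) ^+ 2 = y i 0) ->
  2 *: (points_mx p *m q) =
  diag_of (points_mx p *m (points_mx p)^T) - y + dot q q *: ones R n.
Proof.
move=> hq; apply/colP => i.
rewrite [LHS]mxE points_mx_mul 3!mxE points_mx_gram !mxE -hq enorm_sqr dotBB.
by rewrite (dotC q (p i)); ring.
Qed.

Theorem mainTheorem6 (R : realType) (n : nat) (hn : (4 <= n)%N)
  (D : 'M[R]_n) (hD : edm_of_embedding_dim D 3)
  (p : 'I_n -> 'cV[R]_3) (hp : generating_points D p)
  (hspan : affine_span p = setT) (hsum : \sum_(i < n) p i = 0)
  (dm y : 'cV[R]_n) (hy : optimal_solution D 3 dm y) :
  let P : 'M[R]_(n, 3) := points_mx p in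
  let b : 'cV[R]_n := diag_of (P *m P^T) in
  P^T *m P \in unitmx /\
  exists q : 'cV[R]_3,
    [/\ forall i : 'I_n, enorm (q - p i) ^+ 2 = y i 0,
        forall q' : 'cV[R]_3,
          (forall i : 'I_n, enorm (q' - p i) ^+ 2 = y i 0) -> q' = q,
        q = 2^-1 *: (invmx (P^T *m P) *m P^T *m (b - y)) &
        q^T *m q = n%:R^-1 *: ((ones R n)^T *m (y - b))].
Proof.
move=> P b; have PPu : P^T *m P \in unitmx by exact: spanning_gram_unit.
split=> //.
have n0 : n%:R != 0 :> R by rewrite pnatr_eq0 -lt0n (leq_trans _ hn).
have Pe : P^T *m ones R n = 0.
  rewrite points_mx_tr_mul -[RHS]hsum; apply: eq_bigr => i _.
  by rewrite mxE scale1r.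
(* Stated for an arbitrary [q] at the required distances, the formula also yields uniqueness. *)
have formula q : (forall i, enorm (q - p i) ^+ 2 = y i 0) ->
    q = 2^-1 *: (invmx (P^T *m P) *m P^T *m (b - y)).
  move=> /point_equations /(congr1 (mulmx P^T)); rewrite -/P -/b.
  rewrite mulmxDr -!scalemxAr Pe scaler0 addr0 -mulmxA => <-.
  by rewrite -scalemxAr !mulmxA -(mulmxA _ P^T) mulVmx // mul1mx scalerA mulVf
    ?pnatr_eq0 // scale1r.
have [q hq] := bordered_point (leq_trans (isT : 0 < 4)%N hn) hp hspan hsum hy.1.
exists q; split=> //; last 1 first.
- have /(congr1 (mulmx (ones R n)^T)) := point_equations hq; rewrite -/P -/b.
  (* The left side dies because e^T P is the transpose of P^T e = 0, leaving e^T (y - b) = |q|^2 e^T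
     e, where e^T e = n. *)
  rewrite mulmxDr -!scalemxAr mulmxA -[_ *m P]trmxK trmx_mul trmxK Pe.
  rewrite trmx0 mul0mx scaler0 -[y - b]opprB mulmxN => /esym /eqP.
  rewrite addrC addr_eq0 => /eqP <-.
  apply/matrixP => i j; rewrite !ord1 -/(dot q q) [RHS]mxE [X in _ * X]mxE.
  have -> : ((ones R n)^T *m ones R n) 0 0 = n%:R.
    rewrite mxE (eq_bigr (fun=> 1)) => [|l _]; last by rewrite !mxE mulr1.
    by rewrite sumr_const card_ord.
  by rewrite mulrCA mulVf // mulr1.
- by move=> q' hq'; rewrite (formula q hq) (formula q' hq').
- exact: formula.
Qed.
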